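(* Let $(E,\mathcal{L})$ be a COM with tope set $\mathcal{T}$, let $R\in\mathcal{T}$ and let $e\in E$ define a proper face of $R$. Let $Y\in\mathcal{L}$ be the maximal covector such that $Y\le R$ and $Y_e=0$, and choose $P_{top}\in\mathcal{T}_{R,e}\setminus\mathrm{star}(Y)$ (with $P_{top}\neq\hat0$). Then the open interval $(\hat0,P_{top})_{R,e}$ is contractible. In particular $\mu((\hat0,P_{top})_{R,e})=0$.
   Context: Sign vectors: $(X\circ Y)_e=X_e$ if $X_e\neq0$ else $Y_e$; separator $S(X,Y)=\{e: X_e=-Y_e\neq0\}$. A COM is $(E,\mathcal{L})$, $E$ finite, $\mathcal{L}\subseteq\{0,+,-\}^E$, satisfying (FS): $X\circ(-Y)\in\mathcal{L}$ for $X,Y\in\mathcal{L}$, and (SE): for $X,Y\in\mathcal{L}$, $e\in S(X,Y)$ there is $Z\in\mathcal{L}$ with $Z_e=0$ and $Z_f=(X\circ Y)_f$ for $f\notin S(X,Y)$. Topes are covectors with no zero entries. Sign vectors are ordered componentwise with $0<+$, $0<-$. $\mathrm{star}(X)=\{T\in\mathcal{T}: X\le T\}$. An element $e$ defines a proper face of a tope $P$ if there is a covector $X\in\mathcal{L}$, $X\neq\mathbf{0}$, with $X\le P$ and $X_e=0$; then the composition of all such covectors is the unique maximal one. For $R\in\mathcal{T}$, $P\preceq_R Q$ iff $S(R,P)\subseteq S(R,Q)$; $\mathcal{T}_{R,e}=\{T\in\mathcal{T}: T_e=-R_e\}\cup\{\hat0\}$ with order induced by $\preceq_R$ and artificial least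 element $\hat0$. $(\hat0,P)_{R,e}$ is the open interval $\{Q\in\mathcal{T}_{R,e}:\hat0<Q<P\}$; a poset is contractible if its order complex (chains as faces) is contractible; $\mu$ of an open interval is its Möbius number, equal to $\mu_{\mathcal{T}_{R,e}}(\hat0,P)$ where $\mu(x,x)=1$, $\mu(x,y)=-\sum_{x\le z<y}\mu(x,z)$. *)

(* Defs.v *)
From HB Require Import structures.
From mathcomp Require Import all_boot all_order all_algebra.
From mathcomp Require Import all_classical all_reals topology normedtype.

Set Implicit Arguments.
Unset Strict Implicit.
Unset Printing Implicit Defensive.

Import Order.TTheory GRing.Theory Num.Theory.
Import numFieldNormedType.Exports.

Local Open Scope ring_scope.

Inductive sign := Zero | Pos | Neg.

Definition option_of_sign (s : sign) : option bool :=
  match s with Zero => None | Pos => Some true | Neg => Some false end.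
Definition sign_of_option (o : option bool) : sign :=
  match o with None => Zero | Some true => Pos | Some false => Neg end.
Lemma option_of_signK : cancel option_of_sign sign_of_option.
Proof. by case. Qed.

HB.instance Definition _ := Finite.copy sign (can_type option_of_signK).

Definition sign_opp (s : sign) : sign :=
  match s with Zero => Zero | Pos => Neg | Neg => Pos end.

Definition sign_le (s t : sign) : bool := (s == Zero) || (s == t).

Notation signvec E := {ffun E -> sign}.

Section SignVectors.
Variable E : finType.
Implicit Types X Y : signvec E.

Definition sv0 : signvec E := [ffun=> Zero].
Definition sv_opp X : signvec E := [ffun e => sign_opp (X e)].
Definition sv_comp X Y : signvec E :=
  [ffun e => if X e != Zero then X e else Y e].
Definition sv_le X Y : bool := [forall e, sign_le (X e) (Y e)].
Definition separator X Y : {set E} :=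
  [set e | (X e == sign_opp (Y e)) && (X e != Zero)]%SET.

End SignVectors.

Record com (E : finType) := Com {
  covectors :> {set signvec E};
  com_face_symmetry : forall X Y, X \in covectors -> Y \in covectors ->
    sv_comp X (sv_opp Y) \in covectors;
  com_strong_elimination : forall X Y, X \in covectors -> Y \in covectors ->
    forall e, e \in separator X Y ->
    exists Z, [/\ Z \in covectors, Z e = Zero &
      forall f, f \notin separator X Y -> Z f = sv_comp X Y f] }.

Section Topes.
Variables (E : finType) (L : com E).

Definition topes : {set signvec E} :=
  [set T in covectors L | [forall e, T e != Zero]]%SET.

Definition star (X : signvec E) : {set signvec E} :=
  [set T in topes | sv_le X T]%SET.

Record tope := Tope { tope_val :> signvec E; topeP : tope_val \in topes }.

HB.instance Definition _ := [isSub for tope_val].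
HB.instance Definition _ := [Finite of tope by <:].

Definition defines_proper_face (e : E) (P : tope) : Prop :=
  exists X, [/\ X \in covectors L, X != sv0 E, sv_le X P & X e = Zero].

Definition maximal_face_covector (e : E) (P : tope) (Y : signvec E) : Prop :=
  [/\ Y \in covectors L, sv_le Y P, Y e = Zero &
      forall X, X \in covectors L -> sv_le X P -> X e = Zero ->
        sv_le Y X -> X = Y].

Lemma tope_neq0 (T : tope) e : T e != Zero.
Proof. by case: T => T /=; rewrite inE => /andP[_ /forallP]; apply. Qed.

Lemma separator_tope_inj (R P Q : tope) :
  separator R P = separator R Q -> P = Q.
Proof.
move=> /setP eqS; apply/val_inj/ffunP => e /=.
have := eqS e; rewrite !inE.
by move: (tope_neq0 R e) (tope_neq0 P e) (tope_neq0 Q e);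
  case: (R _) (P _) (Q _) => -[] [].
Qed.

End Topes.

Section TopePoset.
Variables (E : finType) (L : com E) (R : tope L) (e : E).

Definition opp_tope := {T : tope L | T e == sign_opp (R e)}.

HB.instance Definition _ := Finite.on opp_tope.

(* [None] is the artificial least element. *)
Definition tope_poset := option opp_tope.

HB.instance Definition _ := Finite.on tope_poset.

Definition tope_poset_le (x y : tope_poset) : bool :=
  match x, y with
  | None, _ => true
  | Some _, None => false
  | Some P, Some Q => separator R (val P) \subset separator R (val Q)
  end.

Lemma tope_poset_le_refl : reflexive tope_poset_le.
Proof. by case=> /=. Qed.

Lemma tope_poset_le_anti : antisymmetric tope_poset_le.
Proof.
move=> [P|] [Q|] //= /andP[sPQ sQP]; congr Some; apply: val_inj.
by apply: (@separator_tope_inj _ _ R); apply/eqP; rewrite finset.eqEsubset sPQ.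
Qed.

Lemma tope_poset_le_trans : transitive tope_poset_le.
Proof. by move=> [Q|] [P|] [S|] //=; apply: fintype.subset_trans. Qed.

HB.instance Definition _ := Order.Le_isPOrder.Build (Order.Disp tt tt)
  tope_poset tope_poset_le_refl tope_poset_le_anti tope_poset_le_trans.

Lemma tope_poset_le0x (x : tope_poset) : (None <= x :> tope_poset)%O.
Proof. by []. Qed.

HB.instance Definition _ :=
  @Order.hasBottom.Build (Order.Disp tt tt) tope_poset None tope_poset_le0x.

End TopePoset.

Section FinitePosets.
Context {d : Order.disp_t} {T : finPOrderType d}.
Implicit Types (x y : T) (A C : {set T}).

Definition open_interval x y : {set T} := [set z | (x < z < y)%O]%SET.

Definition chain C : bool :=
  [forall x in C, [forall y in C, (x >=< y)%O]].

Definition order_complex A : {set {set T}} :=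
  [set C : {set T} | (C \subset A) && chain C]%SET.

(* [n] bounds the recursion depth; [mobiusE] is the defining recurrence. *)
Fixpoint mobius_rec (n : nat) x y : int :=
  if n is m.+1 then
    if x == y then 1 else - \sum_(z | (x <= z < y)%O) mobius_rec m x z
  else 0.

Definition mobius x y : int := mobius_rec #|T| x y.

Lemma mobius_rec_stable m n x y :
  (#|[set z | (z < y)%O]%SET| < m)%N -> (#|[set z | (z < y)%O]%SET| < n)%N ->
  mobius_rec m x y = mobius_rec n x y.
Proof.
elim: m n y => // m IH [//|n] y; rewrite !ltnS => ym yn /=.
case: eqP => // _; congr (- _); apply: eq_bigr => z /andP[_ zy].
have zS : (#|[set t | (t < z)%O]%SET| < #|[set t | (t < y)%O]%SET|)%N.
  apply/proper_card/fintype.properP; split.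
    by apply/fintype.subsetP => t; rewrite !inE => /lt_trans; apply.
  by exists z; rewrite !inE ?ltxx.
by apply: IH; apply: leq_trans zS _.
Qed.

Lemma mobiusE x y : mobius x y =
  if x == y then 1 else - \sum_(z | (x <= z < y)%O) mobius x z.
Proof.
have lt_card (t : T) : (#|[set z | (z < t)%O]%SET| < #|T|)%N.
  rewrite -[ltnRHS]finset.cardsT; apply/proper_card/fintype.properP; split.
    by apply/fintype.subsetP => z; rewrite inE.
  by exists t; rewrite !inE ?ltxx.
rewrite /mobius (@mobius_rec_stable #|T| #|T|.+1) ?ltnS //; last exact: ltnW.
Qed.

End FinitePosets.

Section Realization.
Local Open Scope classical_set_scope.
Variable RT : realType.

(* Points are given by barycentric coordinates; the topology is that of [RT^V].
   The sum condition excludes the empty support, so the empty face is harmless. *)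
Definition realization (V : finType) (K : {set {set V}}) :
    set {ptws V -> RT} :=
  [set x | [/\ forall v, 0 <= x v, \sum_v x v = 1 &
               [set v | x v != 0]%SET \in K]].

Definition contractible (X : topologicalType) (A : set X) : Prop :=
  exists2 a, A a & exists H : RT * X -> X,
    [/\ {within `[0, 1] `*` A, continuous H},
        forall (t : RT) (x : X), `[0, 1] t -> A x -> A (H (t, x)),
        forall x, A x -> H (0, x) = x &
        forall x, A x -> H (1, x) = a].

Definition contractible_poset d (T : finPOrderType d) (A : {set T}) : Prop :=
  contractible (realization (order_complex A)).

End Realization.

(* Main.v *)
Require Import Defs.
From mathcomp Require Import all_boot all_order all_algebra.
From mathcomp Require Import all_classical all_reals topology normedtype.
From mathcomp Require Import lra.

(** The map [Q |-> Y o Q] on topes is order preserving and satisfies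
    [Q >= Y o Q <= Y o Ptop < Ptop] for [Q <= Ptop], the strict inequality
    because [Ptop] is not in the star of [Y].  So the interval is conically
    contractible: the identity is homotopic to this map, and this map to the
    constant [Y o Ptop].  The same map shows by induction that
    [mu(0, z) = 0] whenever [Y o z <> z]. *)

Set Implicit Arguments.
Unset Strict Implicit.
Unset Printing Implicit Defensive.

Import Order.TTheory GRing.Theory Num.Theory.
Import numFieldNormedType.Exports.

Local Open Scope ring_scope.

(** * Möbius numbers at the nonfixed points of a decreasing monotone map *)

Section Mobius.
Context {d : Order.disp_t} {T : finBPOrderType d}.

(* A fixed point [w] of [f] lies below [z] iff it lies below [f z], so
   the defining sums for [z] and [f z] agree up to terms that vanish by
   induction. *)
Lemma mobius_nonfixed (f : T -> T) (z : T) :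
    (forall x, f x <= x)%O -> {homo f : x y / (x <= y)%O} ->
    (forall x, f x = \bot%O -> x = \bot%O) ->
  f z != z -> mobius \bot%O z = 0.
Proof.
move=> f_le f_mono f_bot.
have [n] := ubnP #|[set t | (t < z)%O]%SET|.
elim: n z => // n IH z; rewrite ltnS => zn fz_neq.
have IHz w : (w < z)%O -> f w != w -> mobius \bot%O w = 0.
  move=> wz; apply: IH; apply: leq_trans zn; apply/proper_card/fintype.properP.
  split; first by apply/fintype.subsetP => t; rewrite !inE => /lt_trans; apply.
  by exists w; rewrite !inE ?ltxx.
have fz_lt : (f z < z)%O by rewrite lt_neqAle fz_neq f_le.
have zN0 : z != \bot%O by rewrite -lt0x (le_lt_trans (le0x _) fz_lt).
have fzN0 : f z != \bot%O by apply: contra_neq zN0 => /f_bot.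
rewrite mobiusE eq_sym (negbTE zN0).
suff -> : \sum_(w | (\bot <= w < z)%O) mobius \bot%O w =
    \sum_(w | (w <= f z)%O) mobius \bot%O w.
  (* Since [f z] is not the bottom, the recurrence at [f z] says that the sum over everything up to
     [f z] vanishes. *)
  rewrite (bigD1 (f z)) //= (mobiusE _ (f z)) eq_sym (negbTE fzN0).
  rewrite [X in _ + X](eq_bigl (fun w => \bot <= w < f z)%O) ?addNr ?oppr0 //.
  by move=> w; rewrite le0x lt_neqAle andbC.
rewrite (bigID (fun w => f w == w)) [RHS](bigID (fun w => f w == w)) /=.
congr (_ + _); last first.
  rewrite !big1 // => w /andP[].
    by move=> wz; apply: IHz; apply: le_lt_trans wz fz_lt.
  by rewrite le0x => wz; apply: IHz.
apply: eq_bigl => w; rewrite le0x /=.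
case: eqP => [fw|_]; rewrite ?andbF ?andbT //.
apply/idP/idP => [wz|wfz]; last exact: le_lt_trans wfz fz_lt.
by rewrite -fw; apply/f_mono/ltW.
Qed.

End Mobius.

Lemma ler_sum_sub (RT : numDomainType) (I : finType) (P Q : pred I)
    (F : I -> RT) :
  (forall i, P i -> Q i) -> (forall i, 0 <= F i) ->
  \sum_(i | P i) F i <= \sum_(i | Q i) F i.
Proof.
move=> PQ F_ge0; rewrite [leRHS](bigID P) /=.
rewrite (eq_bigl P) ?lerDl ?sumr_ge0 // => i.
by apply: andb_idl; exact: PQ.
Qed.

(** * Continuity of real functions and of maps into the pointwise topology *)

Section RealFunctions.
Variables (RT : realType) (U : topologicalType).
Implicit Types g h : U -> RT.

Lemma continuous_addr g h : continuous g -> continuous h ->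
  continuous (fun z => g z + h z).
Proof. by move=> cg ch z; apply: cvgD; [exact: cg | exact: ch]. Qed.

Lemma continuous_oppr g : continuous g -> continuous (fun z => - g z).
Proof. by move=> cg z; apply: cvgN; exact: cg. Qed.

Lemma continuous_mulr g h : continuous g -> continuous h ->
  continuous (fun z => g z * h z).
Proof. by move=> cg ch z; apply: cvgM; [exact: cg | exact: ch]. Qed.

Lemma continuous_sumr (I : finType) (P : pred I) (g : I -> U -> RT) :
  (forall i, continuous (g i)) -> continuous (fun z => \sum_(i | P i) g i z).
Proof. by move=> cg; apply: continuous_big => //; exact: add_continuous. Qed.

Lemma continuous_minr g h : continuous g -> continuous h ->
  continuous (fun z => Num.min (g z) (h z)).
Proof. by move=> cg ch z; apply: continuous_min; [exact: cg | exact: ch]. Qed.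

Lemma continuous_maxr g h : continuous g -> continuous h ->
  continuous (fun z => Num.max (g z) (h z)).
Proof. by move=> cg ch z; apply: continuous_max; [exact: cg | exact: ch]. Qed.

End RealFunctions.

(** The pointwise topology is the supremum of the topologies pulled back along the evaluations, so
    each subbasic neighbourhood involves one coordinate only. *)
Lemma continuous_ptws (U V : topologicalType) (I : choiceType)
    (g : U -> {ptws I -> V}) :
  (forall i, continuous (fun z => g z i)) -> continuous g.
Proof.
move=> cg z; apply/cvg_sup => i A [_ [[W oW <-] Wz] WA].
apply: filterS WA _; apply: cg; exact: open_nbhs_nbhs.
Qed.

(** * Contraction of the order complex by an explicit homotopy *)

Section ConicalContraction.
Variables (RT : realType) (d : Order.disp_t) (T : finPOrderType d).
Variables (f : T -> T) (p : T).
Implicit Types (x : {ptws T -> RT}) (s t : RT) (u v w : T) (A : {set T}).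

(* The masses of the vertices of a chain are laid out from bottom to top along
   [0, 1]; [moved s x v] is the part of the mass of [v] lying in [0, s]. *)
Definition moved s x v : RT :=
  Num.min (x v) (Num.max 0 (s - \sum_(u | (u < v)%O) x u)).

(* Moving the lower vertices first keeps the support a chain
   [f c_0 <= ... <= f c_i <= c_i <= ... <= c_n]. *)
Definition push s x w : RT :=
  x w - moved s x w + \sum_(v | f v == w) moved s x v.

(** Two clocks: [stage1] runs from 0 to 1 while [t] is at most 1/2 and then stays at 1; [stage2]
    stays at 0 until 1/2 and then runs to 1. *)
Definition stage1 t : RT := Num.min 1 (2 * t).
Definition stage2 t : RT := Num.max 0 (2 * t - 1).

(** The first half carries all mass along [f]; the second half is the straight line to the vertex
    [p]. *)
Definition cone_homotopy (tx : RT * {ptws T -> RT}) : {ptws T -> RT} :=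
  fun w => (1 - stage2 tx.1) * push (stage1 tx.1) tx.2 w
           + stage2 tx.1 * (w == p)%:R.

Lemma continuous_cone_homotopy : continuous cone_homotopy.
Proof.
pose X := (RT * {ptws T -> RT} : topologicalType)%type.
have cst (c : RT) : continuous (fun _ : X => c) by exact: cst_continuous.
have cfst : continuous (fun z : X => z.1) by move=> z; exact: cvg_fst.
have ceval v : continuous (fun z : X => z.2 v).
  move=> z; apply: (@cvg_comp _ _ _ snd (fun x : {ptws T -> RT} => x v)).
    exact: cvg_snd.
  exact: (@proj_continuous _ (fun _ => RT) v).
have cadd := @continuous_addr RT X; have copp := @continuous_oppr RT X.
have cmul := @continuous_mulr RT X; have csum := @continuous_sumr RT X.
have cmin := @continuous_minr RT X; have cmax := @continuous_maxr RT X.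
have cs1 : continuous (fun z : RT * {ptws T -> RT} => stage1 z.1).
  by apply: cmin => //; apply: cmul.
have cs2 : continuous (fun z : RT * {ptws T -> RT} => stage2 z.1).
  by apply: cmax => //; apply: cadd => //; apply: cmul.
have cmoved v : continuous
    (fun z : RT * {ptws T -> RT} => moved (stage1 z.1) z.2 v).
  apply: cmin => //; apply: cmax => //; apply: cadd => //; apply: copp.
  exact: csum.
apply: continuous_ptws => w.
apply: (cadd); apply: (cmul) => //; first by apply: cadd => //; exact: copp.
apply: (cadd); last exact: csum.
by apply: cadd => //; exact: copp.
Qed.

Section Mass.
Variable x : {ptws T -> RT}.
Hypothesis x_ge0 : forall v, 0 <= x v.

Lemma moved_ge0 s v : 0 <= moved s x v.
Proof. by rewrite /moved le_min x_ge0 le_max lexx. Qed.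

Lemma moved_le s v : moved s x v <= x v.
Proof. by rewrite /moved ge_min lexx. Qed.

Lemma moved_start v : moved 0 x v = 0.
Proof.
apply/le_anti; rewrite moved_ge0 andbT /moved ge_min ge_max lexx sub0r oppr_le0.
by rewrite sumr_ge0 ?orbT.
Qed.

Lemma push_start : push 0 x = x.
Proof.
by apply/funext => w; rewrite /push moved_start subr0 big1 ?addr0 // => v _;
  rewrite moved_start.
Qed.

(** The total mass is 1, so at least [x v] remains after removing the mass strictly below [v]. *)
Lemma moved_end v : \sum_v x v = 1 -> moved 1 x v = x v.
Proof.
move=> x1; apply: min_l; rewrite le_max lerBrDr -x1; apply/orP; right.
rewrite [X in _ <= X](bigD1 v) //= lerD2l.
by apply: ler_sum_sub => // u; rewrite lt_neqAle => /andP[].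
Qed.

Lemma push_ge0 s w : 0 <= push s x w.
Proof.
by rewrite addr_ge0 ?subr_ge0 ?moved_le // sumr_ge0 // => v _; exact: moved_ge0.
Qed.

(** The mass taken from [v] reappears at [f v]; summing over the fibres of [f] recovers all that was
    taken. *)
Lemma sum_push s : \sum_w push s x w = \sum_w x w.
Proof.
rewrite big_split sumrB /=.
by rewrite [X in _ - X](partition_big f xpredT) // subrK.
Qed.

Lemma push_neq0 s w : push s x w != 0 ->
  moved s x w < x w \/ exists2 v, f v = w & 0 < moved s x v.
Proof.
move=> w_neq0; have [|le_w] := ltP (moved s x w) (x w); first by left.
right; have [/existsP[v /andP[/eqP fv mv]]|] :=
  boolP [exists v, (f v == w) && (0 < moved s x v)]; first by exists v.
rewrite negb_exists => /forallP none; case/eqP: w_neq0.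
rewrite /push (le_anti (introT andP (conj (moved_le s w) le_w))) subrr add0r.
apply: big1 => v fv; apply/le_anti; rewrite moved_ge0 andbT leNgt.
by have := none v; rewrite fv.
Qed.

(** If [w < v], the mass strictly below [v] includes that of [w] and of all below [w]. Once [s]
    exceeds it, so that [v] has begun to move, [w] has moved completely. *)
Lemma moved_below s v w : (v >=< w)%O ->
  0 < moved s x v -> moved s x w < x w -> (v <= w)%O.
Proof.
move=> vw v_moved w_stays; rewrite comparable_leNgt //; apply/negP => wv.
move: v_moved; rewrite /moved lt_min lt_max ltxx /= subr_gt0 => /andP[_ lt_s].
move: w_stays; rewrite /moved gt_min ltxx /= gt_max => /andP[_].
rewrite ltrBlDr ltNge => /negP[]; apply: le_trans (ltW lt_s).
rewrite [X in _ <= X](bigD1 w) //= lerD2l.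
apply: ler_sum_sub => // u uw.
by rewrite (lt_trans uw wv) lt_eqF.
Qed.

End Mass.

Lemma sum_delta : \sum_(w : T) (w == p)%:R = 1 :> RT.
Proof.
by rewrite (bigD1 p) //= eqxx big1 ?addr0 // => w /negbTE ->.
Qed.

Lemma delta_realization A : p \in A ->
  realization (order_complex A) (fun w : T => (w == p)%:R : RT).
Proof.
move=> pA; split; [by move=> w; rewrite ler0n | exact: sum_delta |].
have -> : [set w : T | (w == p)%:R != 0 :> RT]%SET = [set p]%SET.
  by apply/finset.setP => w; rewrite !inE pnatr_eq0 eqb0 negbK.
rewrite inE finset.sub1set pA; apply/forall_inP => u /finset.set1P ->.
by apply/forall_inP => v /finset.set1P ->; exact: comparablexx.
Qed.

(** Quillen's conical contraction: [v >= f v <= p] links the identity to [f] and [f] to the constant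
    [p]. The work lies in showing that supports remain chains in [A]. *)
Lemma contractible_conical A :
    {in A, forall v, f v \in A} -> {in A, forall v, (f v <= v)%O} ->
    {in A &, {homo f : u v / (u <= v)%O}} ->
    p \in A -> {in A, forall v, (f v <= p)%O} ->
  contractible_poset RT A.
Proof.
move=> fA f_le f_mono pA f_p.
exists (fun w : T => (w == p)%:R : RT); first exact: delta_realization.
exists cone_homotopy; split.
- by apply: continuous_subspaceT; exact: continuous_cone_homotopy.
- move=> t x /=; rewrite in_itv /= => /andP[t0 t1] [x0 x1].
  rewrite inE => /andP[/fintype.subsetP xA /forall_inP xC].
  have s0 : 0 <= stage2 t by rewrite /stage2 le_max lexx.
  have s1 : stage2 t <= 1 by rewrite /stage2 ge_max ler01 /=; lra.
  have stage12 : stage2 t != 0 -> stage1 t = 1.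
    rewrite /stage1 /stage2; case: leP; rewrite ?eqxx // => t2 _.
    by apply: min_l; lra.
  have in_supp v : 0 < x v -> v \in [set v | x v != 0]%SET.
    by move=> v0; rewrite inE gt_eqF.
  split.
  + move=> w; rewrite /cone_homotopy /= addr_ge0 ?mulr_ge0 ?ler0n ?subr_ge0 //.
    exact: push_ge0.
  + rewrite /cone_homotopy big_split -!mulr_sumr /= sum_push x1 sum_delta.
    by rewrite !mulr1 subrK.
  pose stays w := moved (stage1 t) x w < x w.
  pose lands w := exists v, [/\ f v = w, v \in [set v | x v != 0]%SET &
                              0 < moved (stage1 t) x v].
  (* A vertex of the new support keeps mass of its own, receives mass through [f], or is the cone
     point, which gains mass from [stage2] only after the first stage is complete. *)
  have supp w : w \in [set w | cone_homotopy (t, x) w != 0]%SET ->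
      [\/ w \in [set v | x v != 0]%SET /\ stays w, lands w |
          w = p /\ stage1 t = 1].
    rewrite inE /cone_homotopy /= => w_neq0.
    have [s2_0|s2_neq0] := eqVneq (stage2 t) 0.
      move: w_neq0; rewrite s2_0 subr0 mul1r mul0r addr0.
      case/(push_neq0 x0) => [w_stays|[v fv mv]].
        by constructor 1; split=> //; apply/in_supp/(le_lt_trans _ w_stays)/moved_ge0.
      constructor 2; exists v; split=> //.
      by apply: in_supp; exact: lt_le_trans mv (moved_le _ _ _).
    have [->|w_p] := eqVneq w p; first by constructor 3; rewrite stage12.
    move: w_neq0; rewrite (negbTE w_p) mulr0 addr0 mulf_eq0 negb_or => /andP[_].
    case/(push_neq0 x0) => [w_stays|[v fv mv]].
      by constructor 1; split=> //; apply/in_supp/(le_lt_trans _ w_stays)/moved_ge0.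
    constructor 2; exists v; split=> //.
    by apply: in_supp; exact: lt_le_trans mv (moved_le _ _ _).
  have comp u v : u \in [set v | x v != 0]%SET -> v \in [set v | x v != 0]%SET ->
      (u >=< v)%O by move=> /xC/forall_inP; exact.
  (* A vertex of [A] need not be comparable with [p]; this rules out that one keeping mass meets the
     cone point. *)
  have stays_end w : stays w -> stage1 t <> 1.
    by move=> + t_end; rewrite /stays t_end moved_end ?ltxx.
  (* Lower vertices move first, so a moved [w] is below a staying [v], whence [f w <= w <= v]. *)
  have lands_stays u v : lands u -> v \in [set v | x v != 0]%SET -> stays v ->
      (u <= v)%O.
    move=> [w [<- wS w_moved]] vS v_stays; apply: le_trans (f_le _ (xA _ wS)) _.
    exact: (moved_below x0 (comp _ _ wS vS) w_moved v_stays).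
  rewrite inE; apply/andP; split.
    apply/fintype.subsetP => w /supp[[/xA //]|[v [<- /xA/fA //]]|[-> //]].
  apply/forall_inP => u /supp uS; apply/forall_inP => v /supp vS.
  case: uS => [[uS u_st]|u_l|[-> t_end]]; case: vS => [[vS v_st]|v_l|[-> t_end']].
  + exact: comp.
  + by rewrite comparable_sym le_comparable ?lands_stays.
  + by case: (stays_end u).
  + by rewrite le_comparable ?lands_stays.
  + case: u_l v_l => [u' [<- u'S _]] [v' [<- v'S _]].
    case/orP: (comp _ _ u'S v'S) => le_uv.
      by apply: le_comparable; apply: f_mono; rewrite ?xA.
    by rewrite comparable_sym le_comparable // f_mono ?xA.
  + by case: u_l => [u' [<- u'S _]]; rewrite le_comparable ?f_p ?xA.
  + by case: (stays_end v).
  + by case: v_l => [v' [<- v'S _]]; rewrite comparable_sym le_comparable ?f_p ?xA.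
  + exact: comparablexx.
- move=> x [x0 _ _]; apply/funext => w; rewrite /cone_homotopy /=.
  rewrite /stage1 /stage2 mulr0 sub0r min_r ?ler01 // max_l ?oppr_le0 ?ler01 //.
  by rewrite push_start // subr0 mul1r mul0r addr0.
- move=> x _; apply/funext => w; rewrite /cone_homotopy /= /stage2.
  have -> : Num.max 0 (2 * 1 - 1) = 1 :> RT by rewrite max_r; lra.
  by rewrite subrr mul0r add0r mul1r.
Qed.

End ConicalContraction.

(** * Composition with a face covector as a decreasing map of the tope poset *)

Section FaceRetraction.
Variables (E : finType) (L : com E).

(** Two uses of (FS): the signs cancel in [X o Z = X o -(X o -Z)]. *)
Lemma sv_comp_covector X Z : X \in covectors L -> Z \in covectors L ->
  sv_comp X Z \in covectors L.
Proof.
move=> XL ZL; rewrite (_ : sv_comp X Z = sv_comp X (sv_opp (sv_comp X (sv_opp Z)))).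
  by apply: com_face_symmetry => //; apply: com_face_symmetry.
by apply/ffunP => i; rewrite !ffunE; case: (X i) => //=; case: (Z i).
Qed.

Lemma sv_comp_tope X (T : tope L) : X \in covectors L ->
  sv_comp X T \in topes L.
Proof.
move=> XL; rewrite inE sv_comp_covector //=; last first.
  by have := topeP T; rewrite inE => /andP[].
apply/forallP => i; rewrite ffunE; case: ifP => // _; exact: tope_neq0.
Qed.

Variables (R : tope L) (e : E) (Y : signvec E).
Hypotheses (YL : Y \in covectors L) (YR : sv_le Y R) (Ye : Y e = Zero).

Definition face_tope (T : tope L) : tope L := Tope (sv_comp_tope T YL).

(** On the support of [Y] the composition agrees with [R], because [Y <= R]; elsewhere it agrees
    with [T]. Both the decrease and the monotonicity of the retraction follow. *)
Lemma separator_face_tope T :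
  separator R (face_tope T) =
    (separator R T :&: [set i | Y i == Zero])%SET.
Proof.
apply/finset.setP => i; rewrite !inE ffunE.
have := forallP YR i; rewrite /sign_le.
by case: (Y i) (R i) (tope_val T i) => [] [] [].
Qed.

Lemma face_tope_opp (T : opp_tope R e) :
  face_tope (val T) e == sign_opp (R e).
Proof. by rewrite /= ffunE Ye eqxx; exact: (valP T). Qed.

Definition face_opp_tope (T : opp_tope R e) : opp_tope R e :=
  exist _ (face_tope (val T)) (face_tope_opp T).

(** The artificial bottom is fixed, and nothing else is sent to it. *)
Definition face_retraction (z : tope_poset R e) : tope_poset R e :=
  omap face_opp_tope z.

Lemma face_retraction_le z : (face_retraction z <= z)%O.
Proof.
case: z => [T|] //.
change (separator R (face_tope (val T)) \subset separator R (val T)).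
by rewrite separator_face_tope finset.subsetIl.
Qed.

Lemma face_retraction_mono : {homo face_retraction : z w / (z <= w)%O}.
Proof.
move=> [S|] [T|] // ST; change (separator R (face_tope (val S)) \subset
  separator R (face_tope (val T))).
by rewrite !separator_face_tope; apply: finset.setSI.
Qed.

Lemma face_retraction_eq0 z : face_retraction z = \bot%O -> z = \bot%O.
Proof. by case: z. Qed.

Lemma face_retraction_fixed (T : opp_tope R e) :
  face_retraction (Some T) = Some T -> tope_val (val T) \in star L Y.
Proof.
move=> [/(congr1 (fun S => tope_val (val S)))/= YT].
rewrite inE (topeP (val T)) -YT; apply/forallP => i.
by rewrite /sign_le ffunE; case: (Y i).
Qed.

End FaceRetraction.

Theorem theorem3p11 (RT : realType) (E : finType) (L : com E)
    (R : tope L) (e : E) (Y : signvec E) (Ptop : opp_tope R e)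
    (eR : defines_proper_face e R)
    (YR : maximal_face_covector e R Y)
    (Ptop_star : tope_val (val Ptop) \notin star L Y) :
  contractible_poset RT
    (open_interval (\bot : tope_poset R e)%O (Some Ptop : tope_poset R e)) /\
  mobius (\bot : tope_poset R e)%O (Some Ptop : tope_poset R e) = 0%R.
Proof.
case: YR => YL leYR Ye _.
pose f := @face_retraction E L R e Y YL Ye.
have f_le z : (f z <= z)%O := face_retraction_le YL leYR Ye z.
have f_mono := face_retraction_mono YL leYR Ye.
have f_neq0 z : (\bot < z)%O -> (\bot < f z)%O.
  by rewrite !lt0x; apply: contra_neq => /face_retraction_eq0.
have fP_neq : f (Some Ptop) != Some Ptop.
  by apply: contraNneq Ptop_star => /face_retraction_fixed.
split; last exact: (mobius_nonfixed f_le f_mono (@face_retraction_eq0 E L R e Y YL Ye)).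
(* The cone point is [Y o Ptop], the image of the excluded upper end; it lies in the open interval
   because [Ptop] is not fixed. *)
apply: (@contractible_conical _ _ _ f (f (Some Ptop))).
- move=> z; rewrite !inE => /andP[z0 zP].
  by rewrite f_neq0 //= (le_lt_trans (f_le z)).
- by move=> z _; exact: f_le.
- by move=> z w _ _; exact: f_mono.
- by rewrite inE f_neq0 ?lt0x // lt_neqAle fP_neq; exact: f_le.
- by move=> z; rewrite inE => /andP[_ /ltW]; exact: f_mono.
Qed.
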